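(* Let $\mathcal X\subseteq\mathbb R^d$ be contained in the closure of its interior, let $\|\cdot\|_{\mathcal X}$ be a norm on $\mathbb R^d$, let $s\in\mathbb N$, and let $K\in\mathcal C^{s,s}(\mathcal X\times\mathcal X,\mathbb R^{Q\times Q})$ be a matrix-valued kernel with vector-valued RKHS $\mathcal F_K$. Let $P\ge1$ and $\mathbf D=[D_{p_1,p_2}]_{p_1,p_2\in[P]}$ with $D_{p_1,p_2}\in O_{Q,s}$ be such that $[D_{p_1,p_2}(\mathbf f)(\mathbf x)]_{p_1,p_2\in[P]}$ is symmetric for all $\mathbf f\in\mathcal F_K$, $\mathbf x\in\mathcal X$. For $\mathbf x',\mathbf x\in\mathcal X$ let $\boldsymbol{\mathcal K}(\mathbf x',\mathbf x)\in\mathbb R^{P\times P\times P\times P}$ be the tensor with entries $$\boldsymbol{\mathcal K}(\mathbf x',\mathbf x)_{p_1,p_2,p_1',p_2'}:=D_{p_1',p_2'}^\top D_{p_1,p_2}K(\mathbf x',\mathbf x),$$ acting as a linear operator on $\mathbb R^{P\times P}$. For $\mathbf z\in\mathcal X$ and $\delta>0$ let $$\eta(\mathbf z,\delta;\mathbf D):=\sup_{\substack{\mathbf x\in\mathbb B_{\mathcal X}(\mathbf z,\delta),\\ \mathbf u\in\mathscr S^{P-1}}}\big|\big\langle\mathbf u\otimes\mathbf u,\ [\boldsymbol{\mathcal K}(\mathbf z,\mathbf z)+\boldsymbol{\mathcal K}(\mathbf x,\mathbf x)-2\boldsymbol{\mathcal K}(\mathbf z,\mathbf x)](\mathbf u\otimes\mathbf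 u)\big\rangle_F\big|^{1/2}.$$ Then for every $\tilde{\mathbf x}_m\in\mathcal X$ and $\delta_m>0$, the quantity $$\eta_{m,P}:=\sup_{\substack{\mathbf x\in\mathbb B_{\mathcal X}(\tilde{\mathbf x}_m,\delta_m),\\ \mathbf u\in\mathscr S^{P-1}}}\Big\|\sum_{p_1,p_2\in[P]}u_{p_1}u_{p_2}\big[D_{p_1,p_2}K(\cdot,\tilde{\mathbf x}_m)-D_{p_1,p_2}K(\cdot,\mathbf x)\big]\Big\|_K$$ can be written as $\eta_{m,P}=\eta(\tilde{\mathbf x}_m,\delta_m;\mathbf D)$.
   Context: $[n]=\{1,\dots,n\}$; $\mathscr S^{P-1}$ is the Euclidean unit sphere of $\mathbb R^P$; $\mathbb B_{\mathcal X}(\mathbf c,r)=\{\mathbf x\in\mathcal X:\|\mathbf x-\mathbf c\|_{\mathcal X}\le r\}$; $\mathbf u\otimes\mathbf u=[u_iu_j]_{i,j}$; $\langle\cdot,\cdot\rangle_F$ is the Frobenius inner product. A tensor $\boldsymbol{\mathcal K}\in\mathbb R^{P\times P\times P\times P}$ acts on $\mathbf A=[a_{n,m}]\in\mathbb R^{P\times P}$ by $(\boldsymbol{\mathcal K}\mathbf A)_{i,j}=\sum_{n,m\in[P]}a_{n,m}\boldsymbol{\mathcal K}_{i,j,n,m}$. Matrix-valued kernel: $K(\mathbf x,\mathbf x')=K(\mathbf x',\mathbf x)^\top$ and $\sum_{i,j}\mathbf v_i^\top K(\mathbf x_i,\mathbf x_j)\mathbf v_j\ge0$ for all finite families. $\mathcal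 F_K$ (norm $\|\cdot\|_K$) is the Hilbert space of functions $\mathcal X\to\mathbb R^Q$ containing all $K(\cdot,\mathbf x)\mathbf c$ with $\langle\mathbf f,K(\cdot,\mathbf x)\mathbf c\rangle_K=\langle\mathbf f(\mathbf x),\mathbf c\rangle$. $\mathcal C^{s,s}(\mathcal X\times\mathcal X,\mathbb R^{Q\times Q})$: functions for which $\partial^{\mathbf r,\mathbf r}$ (order $\mathbf r$ in each of the two arguments) exists and is continuous for all $|\mathbf r|\le s$ (derivatives at non-interior points are continuous extensions from the interior). $O_{1,s}$: operators $f\mapsto\sum_{j\in J}c_j\partial^{\mathbf r_j}f$, $J$ finite, $|\mathbf r_j|\le s$, $c_j\in\mathbb R$. $O_{Q,s}$: operators $D(\mathbf f)(\mathbf x)=\sum_{q\in[Q]}\beta_qD_q(f_q)(\mathbf x)$, $\beta_q\in\mathbb R$, $D_q\in O_{1,s}$. For such $D$, $DK(\mathbf x',\mathbf x):=\sum_q\beta_q\,D_q[\mathbf x''\mapsto K(\mathbf x',\mathbf x'')](\mathbf x)\,\mathbf e_q\in\mathbb R^Q$, and $DK(\cdot,\mathbf x)\in\mathcal F_K$. For $D,\tilde D\in O_{Q,s}$ with $D(\mathbf f)=\sum_q\beta_qD_q(f_q)$ and $\tilde D(\mathbf f)=\sum_q\tilde\beta_q\tilde D_q(f_q)$, $$\tilde D^\top DK(\mathbf x',\mathbf x):=\sum_{q,q'\in[Q]}\tilde\beta_{q'}\beta_q\,\mathbf e_{q'}^\top\,\tilde D_{q',\mathbf x'}D_{q,\mathbf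 x}K(\mathbf x',\mathbf x)\,\mathbf e_q\in\mathbb R,$$ where the subscripts $\mathbf x',\mathbf x$ indicate the variable in which the operator acts. *)

(* Defs.v *)
From HB Require Import structures.
From mathcomp Require Export all_boot all_order all_algebra.
From mathcomp Require Export all_classical all_reals all_analysis.

Set Implicit Arguments.
Unset Strict Implicit.
Unset Printing Implicit Defensive.

Import Order.TTheory GRing.Theory Num.Theory.
Import numFieldNormedType.Exports.

Local Open Scope classical_set_scope.
Local Open Scope ring_scope.

Definition is_norm (R : realType) (d : nat) (N : 'rV[R]_d -> R) : Prop :=
  [/\ forall x, 0 <= N x,
      forall x, N x = 0 -> x = 0,
      forall a x, N (a *: x) = `|a| * N x &
      forall x y, N (x + y) <= N x + N y].

Definition nball (R : realType) (d : nat) (X : set 'rV[R]_d)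
    (N : 'rV[R]_d -> R) (c : 'rV[R]_d) (r : R) : set 'rV[R]_d :=
  [set x | X x /\ N (x - c) <= r].

(* The library's norm on 'cV[R]_P is the max norm, hence the explicit
   Euclidean norm. *)
Definition norm2 (R : realType) (P : nat) (u : 'cV[R]_P) : R :=
  Num.sqrt (\sum_(i < P) u i 0 ^+ 2).

Definition sphere2 (R : realType) (P : nat) : set 'cV[R]_P :=
  [set u | norm2 u = 1].

Definition dotv (R : realType) (Q : nat) (u v : 'cV[R]_Q) : R :=
  \sum_(i < Q) u i 0 * v i 0.

Definition tensv (R : realType) (P : nat) (u : 'cV[R]_P) : 'M[R]_P :=
  \matrix_(i, j) (u i 0 * u j 0).

Definition frobenius (R : realType) (P : nat) (A B : 'M[R]_P) : R :=
  \sum_(i < P) \sum_(j < P) A i j * B i j.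

Definition tensor4 (R : realType) (P : nat) : Type :=
  'I_P -> 'I_P -> 'I_P -> 'I_P -> R.

Definition tensor_act (R : realType) (P : nat) (T : tensor4 R P)
    (A : 'M[R]_P) : 'M[R]_P :=
  \matrix_(i, j) \sum_(n < P) \sum_(m < P) A n m * T i j n m.

Definition mindex (d : nat) : Type := {ffun 'I_d -> nat}.

Definition morder (d : nat) (r : mindex d) : nat := \sum_(i < d) r i.

Definition mseq (d : nat) (r : mindex d) : seq 'I_d :=
  flatten [seq nseq (r i) i | i <- enum 'I_d].

Fixpoint pd_seq (R : realType) (d : nat) (l : seq 'I_d)
    (f : 'rV[R]_d -> R) : 'rV[R]_d -> R :=
  if l is i :: l' then fun x => 'D_(delta_mx 0 i) (pd_seq l' f) x else f.

Fixpoint pd_seq_exists (R : realType) (d : nat) (U : set 'rV[R]_d)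
    (l : seq 'I_d) (f : 'rV[R]_d -> R) : Prop :=
  if l is i :: l' then
    pd_seq_exists U l' f /\
    (forall x, U x -> derivable (pd_seq l' f) x (delta_mx 0 i))
  else True.

(* Only meaningful at interior points of the domain of f. *)
Definition pd (R : realType) (d : nat) (r : mindex d) (f : 'rV[R]_d -> R) :
    'rV[R]_d -> R := pd_seq (mseq r) f.

Definition pd_exists (R : realType) (d : nat) (U : set 'rV[R]_d)
    (r : mindex d) (f : 'rV[R]_d -> R) : Prop := pd_seq_exists U (mseq r) f.

(* Partial derivative of a function on X: at a non-interior point it is the
   limit of the derivative taken along the interior of X (the derivative of
   order 0 is f itself everywhere). *)
Definition pdX (R : realType) (d : nat) (X : set 'rV[R]_d) (r : mindex d)
    (f : 'rV[R]_d -> R) (x : 'rV[R]_d) : R :=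
  if `[< X° x >] || (morder r == 0%N) then pd r f x
  else lim (pd r f y @[y --> within X° (nbhs x)]).

(* C^{s,s}(X x X, R^{Q x Q}).  Functions on X are represented by total
   functions on R^d whose values outside X are irrelevant; G is the continuous
   extension to X x X of the derivative of order (r, r), which is computed on
   the interior, first in the second argument, then in the first one. *)
Definition Css (R : realType) (d Q s : nat) (X : set 'rV[R]_d)
    (K : 'rV[R]_d -> 'rV[R]_d -> 'M[R]_Q) : Prop :=
  forall i j : 'I_Q,
  {within X `*` X, continuous (fun z : 'rV[R]_d * 'rV[R]_d => K z.1 z.2 i j)} /\
  forall r : mindex d, (morder r <= s)%N ->
  [/\ forall x, X° x -> pd_exists X° r (fun x' => K x x' i j),
      forall x', X° x' ->
        pd_exists X° r (fun x => pd r (fun x'' => K x x'' i j) x') &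
      exists2 G : 'rV[R]_d * 'rV[R]_d -> R,
        {within X `*` X, continuous G} &
        forall x x', X° x -> X° x' ->
          G (x, x') = pd r (fun y => pd r (fun x'' => K y x'' i j) x') x].

Definition is_kernel (R : realType) (d Q : nat) (X : set 'rV[R]_d)
    (K : 'rV[R]_d -> 'rV[R]_d -> 'M[R]_Q) : Prop :=
  (forall x x', X x -> X x' -> K x x' = (K x' x)^T) /\
  (forall (n : nat) (x : 'I_n -> 'rV[R]_d) (v : 'I_n -> 'cV[R]_Q),
     (forall i, X (x i)) ->
     0 <= \sum_(i < n) \sum_(j < n) dotv (v i) (K (x i) (x j) *m v j)).

(* The RKHS of K, as a Hilbert space whose elements f are identified, via the
   linear injection rk_ev, with functions X -> R^Q. *)
Record vvRKHS (R : realType) (d Q : nat) (X : set 'rV[R]_d)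
    (K : 'rV[R]_d -> 'rV[R]_d -> 'M[R]_Q) := VVRKHS {
  rk_space :> completeNormedModType R;
  rk_ip : {dot rk_space for idfun};
  rk_normE : forall f : rk_space, `|f| ^+ 2 = rk_ip f f;
  rk_ev : rk_space -> 'rV[R]_d -> 'cV[R]_Q;
  rk_ev_linear : forall (a : R) (f g : rk_space) x, X x ->
    rk_ev (a *: f + g) x = a *: rk_ev f x + rk_ev g x;
  rk_ev_inj : forall f g : rk_space,
    (forall x, X x -> rk_ev f x = rk_ev g x) -> f = g;
  rk_reproducing : forall (x : 'rV[R]_d) (c : 'cV[R]_Q), X x ->
    exists2 k : rk_space,
      (forall x', X x' -> rk_ev k x' = K x' x *m c) &
      (forall f : rk_space, rk_ip f k = dotv (rk_ev f x) c) }.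

(* ||g||_K for a function g : X -> R^Q; the set below has at most one element,
   and the norm is +oo exactly when g is not in the RKHS. *)
Definition rk_norm (R : realType) (d Q : nat) (X : set 'rV[R]_d)
    (K : 'rV[R]_d -> 'rV[R]_d -> 'M[R]_Q) (F : vvRKHS X K)
    (g : 'rV[R]_d -> 'cV[R]_Q) : \bar R :=
  ereal_inf [set (`|h|)%:E | h in
    [set h : F | forall x, X x -> rk_ev h x = g x]].

Record O1 (R : realType) (d s : nat) := MkO1 {
  O1_terms :> seq (R * mindex d);
  O1_order : all (fun t => morder t.2 <= s)%N O1_terms }.

Definition O1_app (R : realType) (d s : nat) (X : set 'rV[R]_d)
    (D : O1 R d s) (f : 'rV[R]_d -> R) (x : 'rV[R]_d) : R :=
  \sum_(t <- O1_terms D) t.1 * pdX X t.2 f x.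

Record OQ (R : realType) (d Q s : nat) := MkOQ {
  OQ_coef : 'I_Q -> R;
  OQ_comp : 'I_Q -> O1 R d s }.

Definition OQ_app (R : realType) (d Q s : nat) (X : set 'rV[R]_d)
    (D : OQ R d Q s) (f : 'rV[R]_d -> 'cV[R]_Q) (x : 'rV[R]_d) : R :=
  \sum_(q < Q) OQ_coef D q * O1_app X (OQ_comp D q) (fun y => f y q 0) x.

(* DK(x', x); the operator D_q acts entrywise on K(x', .). *)
Definition DK (R : realType) (d Q s : nat) (X : set 'rV[R]_d)
    (K : 'rV[R]_d -> 'rV[R]_d -> 'M[R]_Q) (D : OQ R d Q s)
    (x' x : 'rV[R]_d) : 'cV[R]_Q :=
  \sum_(q < Q) OQ_coef D q *:
    ((\matrix_(i < Q, j < Q)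
        O1_app X (OQ_comp D q) (fun x'' => K x' x'' i j) x)
     *m delta_mx q 0).

Definition DtDK (R : realType) (d Q s : nat) (X : set 'rV[R]_d)
    (K : 'rV[R]_d -> 'rV[R]_d -> 'M[R]_Q) (Dt D : OQ R d Q s)
    (x' x : 'rV[R]_d) : R :=
  \sum_(q < Q) \sum_(q' < Q) OQ_coef Dt q' * OQ_coef D q *
    O1_app X (OQ_comp Dt q')
      (fun y' => O1_app X (OQ_comp D q) (fun y => K y' y q' q) x) x'.

Definition Ktensor (R : realType) (d Q s P : nat) (X : set 'rV[R]_d)
    (K : 'rV[R]_d -> 'rV[R]_d -> 'M[R]_Q) (D : 'I_P -> 'I_P -> OQ R d Q s)
    (x' x : 'rV[R]_d) : tensor4 R P :=
  fun p1 p2 p1' p2' => DtDK X K (D p1' p2') (D p1 p2) x' x.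

Definition eta (R : realType) (d Q s P : nat) (X : set 'rV[R]_d)
    (N : 'rV[R]_d -> R) (K : 'rV[R]_d -> 'rV[R]_d -> 'M[R]_Q)
    (D : 'I_P -> 'I_P -> OQ R d Q s) (z : 'rV[R]_d) (delta : R) : \bar R :=
  ereal_sup [set (Num.sqrt `| frobenius (tensv u)
      (tensor_act (fun i j n m =>
         Ktensor X K D z z i j n m + Ktensor X K D x x i j n m
         - 2 * Ktensor X K D z x i j n m) (tensv u)) |)%:E
    | x in nball X N z delta & u in @sphere2 R P].

Definition eta_mP (R : realType) (d Q s P : nat) (X : set 'rV[R]_d)
    (N : 'rV[R]_d -> R) (K : 'rV[R]_d -> 'rV[R]_d -> 'M[R]_Q)
    (F : vvRKHS X K) (D : 'I_P -> 'I_P -> OQ R d Q s)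
    (z : 'rV[R]_d) (delta : R) : \bar R :=
  ereal_sup [set rk_norm F (fun x' =>
      \sum_(p1 < P) \sum_(p2 < P) (u p1 0 * u p2 0) *:
        (DK X K (D p1 p2) x' z - DK X K (D p1 p2) x' x))
    | x in nball X N z delta & u in @sphere2 R P].

(* Main.v *)
(* The identity is |a - b|^2 expanded in the RKHS, once derivative evaluations
   f |-> d^r f_q (x) are known to be represented by elements k_x, with
   <k_x, k_y> the mixed derivative of K.

   At interior x, k_x is the norm limit of the iterated difference quotients of
   x |-> K(., x) e_q as all step sizes tend jointly to 0.  By the mean value
   theorem the inner product of two such quotients is the mixed derivative
   d^(r,r) K_qq at a nearby point, so continuity of that derivative gives the
   Cauchy property.  Freezing one step while letting the others vanish shows
   that <f, k_x> is the iterated partial derivative of f, for every f.  At a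
   boundary point k_x is the limit of k_y over interior y, which is Cauchy
   because <k_y, k_z> is again the mixed derivative. *)
Require Import Defs.
From mathcomp Require Import ring lra.

Set Implicit Arguments.
Unset Strict Implicit.
Unset Printing Implicit Defensive.

Import Order.TTheory GRing.Theory Num.Theory.
Import numFieldNormedType.Exports.
Local Open Scope classical_set_scope.
Local Open Scope ring_scope.

(** * Real inner products that induce the norm *)

Section InnerProduct.
Variables (R : realType) (V : normedModType R) (ip : {dot V for idfun}).
Hypothesis ipE : forall f : V, `|f| ^+ 2 = ip f f.

Lemma ipC (f g : V) : ip f g = ip g f.
Proof. by rewrite hermC expr0 mul1r. Qed.

Lemma ipDr (f g h : V) : ip h (f + g) = ip h f + ip h g.
Proof. exact: linearDr. Qed.

Lemma ipBl (f g h : V) : ip (f - g) h = ip f h - ip g h.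
Proof. exact: linearBl. Qed.

Lemma ipZl a (f h : V) : ip (a *: f) h = a * ip f h.
Proof. exact: linearZl_LR. Qed.

Lemma ipBr (f g h : V) : ip h (f - g) = ip h f - ip h g.
Proof. exact: linearBr. Qed.

Lemma ipZr a (f h : V) : ip h (a *: f) = a * ip h f.
Proof. by rewrite ipC ipZl ipC. Qed.

Lemma ip_sumr I (s : seq I) (P : pred I) (F : I -> V) (h : V) :
  ip h (\sum_(i <- s | P i) F i) = \sum_(i <- s | P i) ip h (F i).
Proof. exact: linear_sumr. Qed.

Lemma ip_suml I (s : seq I) (P : pred I) (F : I -> V) (h : V) :
  ip (\sum_(i <- s | P i) F i) h = \sum_(i <- s | P i) ip (F i) h.
Proof. by rewrite ipC ip_sumr; apply: eq_bigr => i _; rewrite ipC. Qed.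

Lemma norm_ipB (f g : V) :
  `|f - g| ^+ 2 = ip f f + ip g g - 2 * ip f g.
Proof.
by rewrite ipE ipBl !ipBr (ipC g f); ring.
Qed.

(** Cauchy-Schwarz, from the squared norm of [ip g g *: f - ip f g *: g]: its expansion carries a
    factor [ip g g], positive for [g != 0], which cancels without any division. *)
Lemma ip_le_norm (f g : V) : `|ip f g| <= `|f| * `|g|.
Proof.
have [->|g0] := eqVneq g 0.
  by rewrite -[0 : V](scale0r f) ipZr mul0r !normr0 scale0r normr0 mulr0.
have g2 : 0 < ip g g by rewrite -ipE exprn_gt0// normr_gt0.
rewrite -(@ler_pXn2r _ 2)// ?nnegrE ?mulr_ge0//.
rewrite exprMn !ipE real_normK ?num_real//.
have := sqr_ge0 `|ip g g *: f - ip f g *: g|.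
rewrite norm_ipB !ipZl !ipZr => h.
have : 0 <= ip g g * (ip f f * ip g g - ip f g ^+ 2) by nra.
by rewrite pmulr_rge0// subr_ge0.
Qed.

End InnerProduct.

(** * Iterated difference quotients and their mean value theorem *)

Fixpoint dq (R : realType) (d : nat) (V : normedModType R)
    (l : seq ('I_d * R)) (f : 'rV[R]_d -> V) (y : 'rV[R]_d) : V :=
  if l is p :: l' then
    p.2^-1 *: (dq l' f (p.2 *: delta_mx 0 p.1 + y) - dq l' f y)
  else f y.

Definition small_steps (R : realType) (d : nat) (e : R)
    (l : seq ('I_d * R)) : bool :=
  all (fun p => 0 < `|p.2| <= e) l.

Section DifferenceQuotients.
Variables (R : realType) (d : nat).
Implicit Types (U : set 'rV[R]_d) (l : seq ('I_d * R)) (i : 'I_d)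
  (x y : 'rV[R]_d).

Lemma norm_scale_delta (t : R) i : `|t *: delta_mx 0 i : 'rV[R]_d| <= `|t|.
Proof.
rewrite [leLHS]/Num.Def.normr/= mx_normrE; apply: bigmax_le => // -[a b] _ /=.
by rewrite !mxE ord1 eqxx/=; case: eqP; rewrite ?mulr1// mulr0 normr0.
Qed.

(** Radius bookkeeping for the inductions below: a quotient with [n] steps of size at most [e]
    samples only points within [n * e] of its base point. *)
Lemma norm_sub_step (n : nat) (e t : R) i y z :
  `|t| <= e -> `|z - (t *: delta_mx 0 i + y)| <= n%:R * e ->
  `|z - y| <= n.+1%:R * e.
Proof.
move=> te zy; rewrite -(subrK (t *: delta_mx 0 i + y) z) -addrA addrK.
apply: (le_trans (ler_normD _ _)); rewrite -natr1 mulrDl mul1r lerD//.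
exact: le_trans (norm_scale_delta _ _) te.
Qed.

Lemma dq_ext (V : normedModType R) l (e : R) (f g : 'rV[R]_d -> V) y :
  small_steps e l ->
  (forall z, `|z - y| <= (size l)%:R * e -> f z = g z) ->
  dq l f y = dq l g y.
Proof.
elim: l y => [y _ fg|[i t] l IH y /= /andP[/andP[t0 te] sl] fg].
  by apply: fg; rewrite subrr normr0 mul0r.
have e0 : 0 <= e by exact: le_trans te.
rewrite (IH y)// => [|z zy]; last first.
  by apply: fg; apply: (le_trans zy); rewrite ler_wpM2r// ler_nat.
by rewrite IH// => z zy; apply: fg; exact: norm_sub_step te zy.
Qed.

Lemma dq_rcons (V : normedModType R) l p (f : 'rV[R]_d -> V) y :
  dq (rcons l p) f y = dq l (dq [:: p] f) y.
Proof. by elim: l y => //= q l IH y; rewrite !IH. Qed.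

(** The hypothesis on [phi] covers exactly the operation that [dq] performs, so an inner product
    with either slot fixed qualifies. *)
Lemma dq_linear (V W : normedModType R) (phi : V -> W) l
    (f : 'rV[R]_d -> V) y :
  (forall a u v, phi (a *: (u - v)) = a *: (phi u - phi v)) ->
  phi (dq l f y) = dq l (phi \o f) y.
Proof. by move=> lphi; elim: l y => //= p l IH y; rewrite lphi !IH. Qed.

Lemma dq_commute (V : normedModType R) l p (f : 'rV[R]_d -> V) y :
  dq l (dq [:: p] f) y = dq [:: p] (dq l f) y.
Proof.
elim: l y => //= q l IH y; rewrite !IH /= !scalerBr !scalerA.
rewrite [p.2^-1 * _]mulrC (addrCA (q.2 *: _)) !opprB -!addrA.
by congr (_ + _); rewrite addrCA [RHS]addrCA; congr (_ + _); exact: addrC.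
Qed.

(** A discrete Fubini theorem: quotients in independent variables are finite linear combinations, so
    their order is immaterial. *)
Lemma dq_exchange (V : normedModType R) l l'
    (H : 'rV[R]_d -> 'rV[R]_d -> V) x y :
  dq l (fun x => dq l' (H x) y) x = dq l' (fun y => dq l (H ^~ y) x) y.
Proof.
elim: l x => //= p l IH x; rewrite !IH.
elim: l' y {IH} => //= q l' IH y; rewrite -!IH !scalerBr !scalerA.
rewrite [p.2^-1 * _]mulrC !opprB -!addrA; congr (_ + _).
by rewrite addrCA [RHS]addrCA; congr (_ + _); exact: addrC.
Qed.

Lemma eq_pd_seq U (l : seq 'I_d) (f g : 'rV[R]_d -> R) x :
  open U -> (forall x, U x -> f x = g x) -> U x -> pd_seq l f x = pd_seq l g x.
Proof.
move=> oU fg; elim: l x => [//|i l IH x Ux /=]; apply: near_eq_derive.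
exact: filterS (open_nbhs_nbhs (conj oU Ux)).
Qed.

(** Existence and formula go through one induction: the next derivative exists because the formula
    already holds on a neighbourhood, which openness of [U] provides. *)
Lemma pd_seq_quotient U (l : seq 'I_d) (f g : 'rV[R]_d -> R) (c : R) :
  open U -> pd_seq_exists U l f -> pd_seq_exists U l g ->
  pd_seq_exists U l (fun x => c *: (f x - g x)) /\
  (forall x, U x -> pd_seq l (fun x => c *: (f x - g x)) x =
     c *: (pd_seq l f x - pd_seq l g x)).
Proof.
move=> oU; elim: l => [//|i l IH /= [/IH{}IH fd] [/IH[hex hE] gd]].
have nfg x : U x -> \near x, (c \*: (pd_seq l f - pd_seq l g)) x =
    pd_seq l (fun x => c *: (f x - g x)) x.
  move=> Ux; apply: filterS (open_nbhs_nbhs (conj oU Ux)) => z Uz.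
  by rewrite hE.
split; first (split; [exact: hex|move=> x Ux]).
  apply: near_eq_derivable (nfg x Ux) _.
  by apply: derivableZ; apply: derivableB; [exact: fd|exact: gd].
move=> x Ux; rewrite -(near_eq_derive _ (nfg x Ux)).
rewrite deriveZ; last by apply: derivableB; [exact: fd|exact: gd].
by rewrite deriveB//; [exact: fd|exact: gd].
Qed.

(** Differencing in one variable commutes with differentiating in the other, since the quotient is a
    finite combination of the functions [H x]. *)
Lemma pd_seq_dq U (l : seq 'I_d) l' (e : R)
    (H : 'rV[R]_d -> 'rV[R]_d -> R) x0 :
  open U -> small_steps e l' ->
  (forall x, `|x - x0| <= (size l')%:R * e -> pd_seq_exists U l (H x)) ->
  pd_seq_exists U l (fun y => dq l' (H ^~ y) x0) /\
  (forall y, U y -> pd_seq l (fun y => dq l' (H ^~ y) x0) y =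
     dq l' (fun x => pd_seq l (H x) y) x0).
Proof.
move=> oU; elim: l' x0 => [x0 _ Hex|[i t] l' IH x0 /= /andP[/andP[t0 te] sl] Hex].
  by split=> //; apply: Hex; rewrite subrr normr0 mul0r.
have e0 : 0 <= e by exact: le_trans te.
have [|ex1 E1] := IH x0 sl.
  by move=> x xx0; apply: Hex; apply: (le_trans xx0); rewrite ler_wpM2r// ler_nat.
have [x xx0|ex2 E2] := IH (t *: delta_mx 0 i + x0) sl.
  by apply: Hex; exact: norm_sub_step te xx0.
have [ex E] := pd_seq_quotient t^-1 oU ex2 ex1.
by split=> // y Uy; rewrite E// E1// E2.
Qed.

Lemma pd_seq_rcons (l : seq 'I_d) i (f : 'rV[R]_d -> R) :
  pd_seq (rcons l i) f = pd_seq l (fun x => 'D_(delta_mx 0 i) f x).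
Proof. by elim: l => //= j l ->. Qed.

Lemma pd_seq_exists_rcons U (l : seq 'I_d) i (f : 'rV[R]_d -> R) :
  pd_seq_exists U (rcons l i) f ->
  pd_seq_exists U l (fun x => 'D_(delta_mx 0 i) f x) /\
  (forall x, U x -> derivable f x (delta_mx 0 i)).
Proof.
elim: l => [|j l IH]; first by case.
case=> /IH[ex df] dl; split; last exact: df.
by split; [exact: ex|move: dl; rewrite pd_seq_rcons].
Qed.

Lemma quotient_mvt (f : 'rV[R]_d -> R) y (v : 'rV[R]_d) (t : R) :
  t != 0 ->
  (forall c, `|c| <= `|t| -> derivable f (c *: v + y) v) ->
  exists2 c, `|c| <= `|t| &
    t^-1 *: (f (t *: v + y) - f y) = 'D_v f (c *: v + y).
Proof.
move=> t0 df.
pose phi (c : R) := f (c *: v + y).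
(* The increment quotients of [phi] at [c] and of [f] along [v] are the same function of [h], so
   derivability and derivative both transfer. *)
have phiE c : (fun h : R => h^-1 *: ((phi \o shift c) (h *: (1 : R)) - phi c)) =
    (fun h : R => h^-1 *: ((f \o shift (c *: v + y)) (h *: v) - f (c *: v + y))).
  apply/funext => h; rewrite /phi /= /shift/=.
  by rewrite [h%:A]mulr1 scalerDl addrA.
have dphi c : `|c| <= `|t| -> is_derive c (1 : R) phi ('D_v f (c *: v + y)).
  move=> /df dfc; apply: DeriveDef.
    by rewrite /derivable phiE.
  by rewrite /derive phiE.
have cphi a b : (forall c, a <= c <= b -> `|c| <= `|t|) ->
    {within `[a, b], continuous phi}.
  move=> ab; apply: derivable_within_continuous => c; rewrite in_itv/= => /ab.
  by move=> /dphi[].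
have [tp|tn] := ltP 0 t.
  have H c : 0 <= c <= t -> `|c| <= `|t|.
    by move=> /andP[c0 ct]; rewrite !ger0_norm// ltW.
  have [|c ct E] := @MVT_segment _ phi (fun c => 'D_v f (c *: v + y)) 0 t
      (ltW tp) _ (cphi _ _ H).
    move=> c; rewrite in_itv/= => /andP[c0 ct].
    by apply: dphi; apply: H; rewrite !ltW.
  exists c; first by apply: H; move: ct; rewrite in_itv.
  have := E; rewrite /phi scale0r add0r subr0 => ->.
  by rewrite [_ *: _]mulrC mulfK.
(* For negative [t] the theorem is applied on [[t, 0]], and the two sign changes cancel. *)
have H c : t <= c <= 0 -> `|c| <= `|t|.
  by move=> /andP[c0 ct]; rewrite !ler0_norm// lerN2.
have [|c ct E] := @MVT_segment _ phi (fun c => 'D_v f (c *: v + y)) t 0 tn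
    _ (cphi _ _ H).
  by move=> c; rewrite in_itv/= => /andP[c0 ct]; apply: dphi; apply: H; rewrite !ltW.
exists c; first by apply: H; move: ct; rewrite in_itv.
have := E; rewrite /phi scale0r add0r sub0r mulrN => E'.
by rewrite -opprB E' opprK [_ *: _]mulrC mulfK.
Qed.

Lemma is_derive_dq l (e : R) (f : 'rV[R]_d -> R) y (v : 'rV[R]_d) :
  small_steps e l ->
  (forall z, `|z - y| <= (size l)%:R * e -> derivable f z v) ->
  is_derive y v (dq l f) (dq l (fun x => 'D_v f x) y).
Proof.
elim: l y => [y _ df|[i t] l IH y /= /andP[/andP[t0 te] sl] df].
  by apply/derivableP/df; rewrite subrr normr0 mul0r.
have e0 : 0 <= e by exact: le_trans te.
have IH1 : is_derive y v (dq l f) (dq l (fun x => 'D_v f x) y).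
  by apply: IH => // z zw; apply/df/(le_trans zw); rewrite ler_wpM2r// ler_nat.
pose w : 'rV[R]_d := t *: delta_mx 0 i.
have IH2 : is_derive (w + y) v (dq l f) (dq l (fun x => 'D_v f x) (w + y)).
  by apply: IH => // z zw; apply/df; exact: norm_sub_step te zw.
have {}IH2 : is_derive y v (fun z => dq l f (w + z))
    (dq l (fun x => 'D_v f x) (w + y)).
  case: IH2 => d1 d2.
  have E : (fun h : R => h^-1 *: ((dq l f \o shift (w + y)) (h *: v)
        - dq l f (w + y))) =
      (fun h : R => h^-1 *: (((fun z => dq l f (w + z)) \o shift y) (h *: v)
        - dq l f (w + y))).
    by apply/funext => h /=; rewrite addrCA.
  by apply: DeriveDef; rewrite /derivable /derive -E.
exact: (@is_deriveZ _ _ _ _ t^-1 _ _ _ (is_deriveB IH2 IH1)).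
Qed.

(** Induction from the innermost step, at the end of the list. Commuted to the outside, it becomes a
    derivative by the one-variable theorem; that derivative passes through the remaining quotient,
    which is then a shorter quotient of a partial derivative of [f]. *)
Lemma dq_mvt U l (e : R) (f : 'rV[R]_d -> R) y :
  small_steps e l ->
  (forall z, `|z - y| <= (size l)%:R * e -> U z) ->
  pd_seq_exists U (unzip1 l) f ->
  exists2 z, `|z - y| <= (size l)%:R * e & dq l f y = pd_seq (unzip1 l) f z.
Proof.
elim/last_ind: l f y => [f y _ _ _|l [i t] IH f y].
  by exists y => //; rewrite subrr normr0 mul0r.
rewrite /small_steps all_rcons => /andP[/= /andP[t0 te] sl].
have e0 : 0 <= e by exact: le_trans te.
rewrite /unzip1 map_rcons -/(unzip1 l) size_rcons /=.
move=> yU /pd_seq_exists_rcons[ex df].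
rewrite dq_rcons pd_seq_rcons.
have dF c : `|c| <= `|t| -> is_derive (c *: delta_mx 0 i + y) (delta_mx 0 i)
    (dq l f) (dq l (fun x => 'D_(delta_mx 0 i) f x) (c *: delta_mx 0 i + y)).
  move=> ct; apply: is_derive_dq sl _ => z zc.
  by apply/df/yU; exact: norm_sub_step (le_trans ct te) zc.
have tn0 : t != 0 by rewrite -normr_gt0.
have [c ct E] := @quotient_mvt (dq l f) y (delta_mx 0 i) t tn0
  (fun c ct => @ex_derive _ _ _ _ _ _ _ (dF c ct)).
have [z zc E'] := IH (fun x => 'D_(delta_mx 0 i) f x) (c *: delta_mx 0 i + y) sl
  (fun z zc => yU _ (norm_sub_step (le_trans ct te) zc)) ex.
exists z; first exact: norm_sub_step (le_trans ct te) zc.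
by rewrite -E' dq_commute /= E (@derive_val _ _ _ _ _ _ _ (dF c ct)).
Qed.

End DifferenceQuotients.

(** * Convergence through inner products, and the filter of vanishing steps *)

Lemma cvg_ip (R : realType) (V : normedModType R) (ip : {dot V for idfun})
    (ipE : forall f : V, `|f| ^+ 2 = ip f f) (I : Type) (F : set_system I)
    {FF : Filter F} (a : I -> V) (b f : V) :
  a i @[i --> F] --> b -> ip f (a i) @[i --> F] --> ip f b.
Proof.
move=> /cvgrPdist_le ab; apply/cvgrPdist_le => e e0.
(* Adding 1 avoids a separate case for [f = 0]. *)
have f0 : 0 < `|f| + 1 by rewrite ltr_wpDl.
have := ab (e / (`|f| + 1)) (divr_gt0 e0 f0); apply: filterS => i abi.
rewrite -ipBr (le_trans (ip_le_norm ipE _ _))//.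
move: abi; rewrite ler_pdivlMr// mulrC => /(le_trans _); apply.
by rewrite ler_wpM2r// lerDl.
Qed.

(** If all Gram entries approach the same [g], the squared distance of [a i] and [a j] approaches
    [g + g - 2 * g = 0], so the family is Cauchy. *)
Lemma gram_cvg (R : realType) (V : completeNormedModType R)
    (ip : {dot V for idfun}) (ipE : forall f : V, `|f| ^+ 2 = ip f f)
    (I : Type) (F : set_system I) {FF : ProperFilter F} (a : I -> V) (g : R) :
  (forall e : R, 0 < e -> exists2 A, F A &
    forall i j, A i -> A j -> `|ip (a i) (a j) - g| <= e) ->
  cvg (a i @[i --> F]).
Proof.
move=> H; apply: cauchy_cvg; apply/cauchyP => e e0.
(* Four errors of this size add up to [e ^+ 2 / 2], strictly below [e ^+ 2]. *)
have e8 : 0 < e ^+ 2 / 8 by rewrite divr_gt0// exprn_gt0.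
have [A FA HA] := H _ e8.
have [i Ai] := filter_ex FA.
exists (a i); change (F [set j | ball (a i) e (a j)]); apply: filterS FA => j Aj.
rewrite /= -ball_normE/= -(@ltr_pXn2r _ 2)// ?nnegrE ?normr_ge0 ?(ltW e0)//.
rewrite (norm_ipB ipE).
move: (HA _ _ Ai Ai) (HA _ _ Aj Aj) (HA _ _ Ai Aj); rewrite !ler_norml.
have : 0 < e ^+ 2 by rewrite exprn_gt0.
move=> ? /andP[? ?] /andP[? ?] /andP[? ?].
lra.
Qed.

(** A joint limit, not an iterated one: its bound is uniform over all small steps, so one step can
    be held fixed while the others vanish. *)
Definition steps (R : realType) (d : nat) (l : seq 'I_d) :
    set_system (seq ('I_d * R)) :=
  filter_from [set e : R | 0 < e]
    (fun e => [set l' | unzip1 l' = l /\ small_steps e l']).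

Arguments steps R {d} l.

Global Instance steps_filter (R : realType) (d : nat) (l : seq 'I_d) :
  ProperFilter (steps R l).
Proof.
apply: filter_from_proper => [|e /= e0]; last first.
  exists [seq (i, e) | i <- l]; split.
    by rewrite /unzip1 -map_comp map_id.
  by apply/allP => _ /mapP[i _ ->] /=; rewrite gtr0_norm// e0 lexx.
apply: filter_from_filter => [|a b /= a0 b0]; first by exists 1 => /=.
exists (Num.min a b); first by rewrite /= lt_min a0 b0.
move=> l' [? s]; split; split => //; apply: sub_all s => p /andP[-> ] /=;
  by rewrite le_min => /andP[].
Qed.

(** * Representers of derivatives for a feature map [phi] with kernel [k] *)

Section ReproducingDerivatives.
Variables (R : realType) (d : nat) (V : completeNormedModType R).
Variable (ip : {dot V for idfun}).
Hypothesis ipE : forall f : V, `|f| ^+ 2 = ip f f.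
Variables (U : set 'rV[R]_d) (phi : 'rV[R]_d -> V).
Hypothesis oU : open U.
Variable k : 'rV[R]_d -> 'rV[R]_d -> R.
Hypothesis kE : forall x y, U x -> U y -> ip (phi x) (phi y) = k x y.

Definition mixed_pd (l : seq 'I_d) (x y : 'rV[R]_d) : R :=
  pd_seq l (fun x => pd_seq l (k x) y) x.

Definition mixed_pd_exists (l : seq 'I_d) : Prop :=
  (forall x, U x -> pd_seq_exists U l (k x)) /\
  (forall y, U y -> pd_seq_exists U l (fun x => pd_seq l (k x) y)).

(** Only the limit at a diagonal point is asked for, and [x0] may lie outside [U]; this serves
    interior and boundary points alike. *)
Definition mixed_pd_limit (l : seq 'I_d) (x0 : 'rV[R]_d) : Prop :=
  exists g : R, forall e : R, 0 < e -> exists2 r, 0 < r &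
    forall x y, U x -> U y -> `|x - x0| <= r -> `|y - x0| <= r ->
      `|mixed_pd l x y - g| <= e.

(** By bilinearity the inner product is a double quotient of [k]; the mean value theorem, used once
    in each variable, turns it into [mixed_pd] at two points near [x0]. *)
Lemma dq_gram (l : seq 'I_d) x0 : U x0 ->
  mixed_pd_exists l -> mixed_pd_limit l x0 ->
  exists g : R, forall e : R, 0 < e -> exists2 A, steps R l A &
    forall l1 l2, A l1 -> A l2 ->
      `|ip (dq l1 phi x0) (dq l2 phi x0) - g| <= e.
Proof.
move=> Ux0 [ex2 ex1] [g Hg]; exists g => e /Hg[r r0 Hr].
have /nbhs_closedballP[r' Hr'] : nbhs x0 U by exact: open_nbhs_nbhs.
(* All sample points must stay in [U] (radius [r']) and where [mixed_pd] is close to [g] (radius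
   [r]). The successor keeps the divisor nonzero for empty [l]. *)
pose a := Num.min r r'%:num / (size l).+1%:R.
have a0 : 0 < a by rewrite divr_gt0// lt_min r0/=.
have la : (size l)%:R * a <= Num.min r r'%:num.
  rewrite /a mulrCA ler_piMr//; first by rewrite le_min !ltW.
  by rewrite ler_pdivrMr// mul1r ler_nat.
have UB z : `|z - x0| <= (size l)%:R * a -> U z.
  move=> zx; apply: Hr'; rewrite closed_ballE// /closed_ball_ /= distrC.
  by rewrite (le_trans zx)// (le_trans la)// ge_min lexx orbT.
exists [set l' | unzip1 l' = l /\ small_steps a l']; first by exists a.
move=> l1 l2 [l1l sl1] [l2l sl2].
have s1 : size l1 = size l by rewrite -l1l size_map.
have s2 : size l2 = size l by rewrite -l2l size_map.
have -> : ip (dq l1 phi x0) (dq l2 phi x0) =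
    dq l2 (fun y => dq l1 (k ^~ y) x0) x0.
  rewrite (@dq_linear _ _ _ _ (ip ^~ (dq l2 phi x0))); last first.
    by move=> c u v; rewrite ipZl ipBl.
  (* The first variable is differenced inside, so that the mean value point in
     the second one is the same for all points of the first quotient. *)
  rewrite -dq_exchange; apply: (dq_ext sl1) => x; rewrite s1 => /UB Ux.
  rewrite /= (@dq_linear _ _ _ _ (ip (phi x))); last first.
    by move=> c u v; rewrite ipZr ipBr.
  by apply: (dq_ext sl2) => y; rewrite s2 => /UB Uy /=; exact: kE.
have [|ex E] := pd_seq_dq (H := k) (x0 := x0) oU sl1 (l := l).
  by move=> x; rewrite s1 => /UB; exact: ex2.
have := @dq_mvt _ _ U _ _ (fun y => dq l1 (k ^~ y) x0) x0 sl2.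
rewrite s2 l2l => /(_ UB ex)[y yx0 ->]; rewrite E; last exact: UB.
have := @dq_mvt _ _ U _ _ (fun x => pd_seq l (k x) y) x0 sl1.
rewrite s1 l1l => /(_ UB (ex1 _ (UB _ yx0)))[x xx0 ->].
apply: Hr; [exact: UB|exact: UB|apply: (le_trans xx0)|apply: (le_trans yx0)];
  by rewrite (le_trans la)// ge_min lexx.
Qed.

Definition derivative_repr (l : seq 'I_d) (x : 'rV[R]_d) : V :=
  lim (dq l' phi x @[l' --> steps R l]).

Lemma dq_cvg (l : seq 'I_d) x : U x ->
  mixed_pd_exists l -> mixed_pd_limit l x ->
  dq l' phi x @[l' --> steps R l] --> derivative_repr l x.
Proof.
move=> Ux exl liml; have [g Hg] := dq_gram Ux exl liml.
exact: (gram_cvg ipE Hg).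
Qed.

(** [C] stands for the admissible derivatives. Closure under removing the head, which is the
    outermost derivative, is what induction on the order needs. *)
Variable C : seq 'I_d -> Prop.
Hypothesis C_behead : forall i l, C (i :: l) -> C l.
Hypothesis C_exists : forall l, C l -> mixed_pd_exists l.
Hypothesis C_limit : forall l x, C l -> U x -> mixed_pd_limit l x.

(** In the induction step, the quotient of [derivative_repr l] in direction [i] with step [h] is a
    limit of full quotients whose first step is frozen at [h]; joint convergence puts these near
    [derivative_repr (i :: l) y]. *)
Lemma derivative_reprP (l : seq 'I_d) (f : V) : C l ->
  pd_seq_exists U l (fun y => ip f (phi y)) /\
  (forall y, U y ->
    pd_seq l (fun y => ip f (phi y)) y = ip f (derivative_repr l y)).
Proof.
elim: l => [|i l IH] Cl.
  split=> // y Uy /=; congr (ip f _).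
  (* With no directions the filter sees only the empty step list, so the limit is [phi y]. *)
  apply/esym; apply: cvg_lim => //; apply/cvgrPdist_le => e e0.
  exists 1 => [|l' [+ _]]; first exact: ltr01.
  by case: l' => // _; rewrite /= subrr normr0 ltW.
have Cl' := C_behead Cl; have [ex E] := IH Cl'.
suff H y : U y -> h^-1 *: ((pd_seq l (fun y => ip f (phi y)) \o shift y)
      (h *: (delta_mx 0 i : 'rV[R]_d)) - pd_seq l (fun y => ip f (phi y)) y)
      @[h --> 0^'] --> ip f (derivative_repr (i :: l) y).
  split; first by split=> // y /H Hy; apply/cvg_ex; eexists; exact: Hy.
  by move=> y /H Hy; apply: cvg_lim.
move=> Uy; apply/cvgrPdist_le => e e0.
have f0 : 0 < `|f| + 1 by rewrite ltr_wpDl.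
have cvgl z : U z -> dq l' phi z @[l' --> steps R l] --> derivative_repr l z.
  by move=> Uz; apply: dq_cvg => //; [exact: C_exists|exact: C_limit].
have /cvgrPdist_le/(_ _ (divr_gt0 e0 f0))[r /= r0 Hr] :=
  dq_cvg Uy (C_exists Cl) (C_limit Cl Uy).
have nU : \forall h \near (0 : R)^', U (h *: delta_mx 0 i + y).
  have : h *: (delta_mx 0 i : 'rV[R]_d) + y @[h --> (0:R)^'] --> y.
    rewrite [X in _ --> X](_ : y = (0 : R) *: delta_mx 0 i + y); last first.
      by rewrite scale0r add0r.
    apply: cvgD; last exact: cvg_cst.
    by apply: cvgZl; apply: cvg_within.
  by apply; exact: open_nbhs_nbhs.
near=> h.
have h0 : h != 0 by near: h; exact: nbhs_dnbhs_neq.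
have hr : `|h| <= r by near: h; apply: dnbhs0_le.
have Uh : U (h *: delta_mx 0 i + y) by near: h.
rewrite /= /shift/= !E// -ipBr.
have -> (a : R) u : a *: ip f u = ip f (a *: u) by rewrite ipZr.
rewrite -ipBr.
rewrite (le_trans (ip_le_norm ipE _ _))//.
suff : `|derivative_repr (i :: l) y - h^-1 *:
    (derivative_repr l (h *: delta_mx 0 i + y) - derivative_repr l y)|
    <= e / (`|f| + 1).
  rewrite ler_pdivlMr// mulrC => /(le_trans _); apply.
  by rewrite ler_wpM2r// lerDl.
have : dq ((i, h) :: l') phi y @[l' --> steps R l] --> h^-1 *:
    (derivative_repr l (h *: delta_mx 0 i + y) - derivative_repr l y).
  by apply: cvgZr; apply: cvgB; exact: cvgl.
(* Some [l'] with steps at most [r] brings the quotient within [b] of its limit for fixed [h]; the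
   choice of [r] also puts it within the target bound of [derivative_repr (i :: l) y]. The slack [b]
   is arbitrary. *)
move=> /cvgrPdist_le Hh; apply/ler_addgt0Pr => b b0.
have := Hh b b0; near_simpl => Hb.
have Hs : steps R l [set l' | unzip1 l' = l /\ small_steps r l'] by exists r.
have [l' [/= /= Hl1 [ul sl]]] := filter_ex (filterI Hb Hs).
rewrite -(subrK (dq ((i, h) :: l') phi y) (derivative_repr (i :: l) y)) -addrA.
rewrite (le_trans (ler_normD _ _))// lerD//; last by rewrite distrC.
by apply: Hr; rewrite /= ul; split=> //=; rewrite normr_gt0 h0 hr.
Unshelve. all: by end_near. Qed.

(** The representing property is used once in each slot. The outer derivative falls on [y], hence
    the swapped arguments. *)
Lemma derivative_repr_gram (l : seq 'I_d) x y : C l -> U x -> U y ->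
  ip (derivative_repr l x) (derivative_repr l y) = mixed_pd l y x.
Proof.
move=> Cl Ux Uy; have [ex E] := derivative_reprP (derivative_repr l x) Cl.
have kx z : U z -> ip (derivative_repr l x) (phi z) = pd_seq l (k z) x.
  move=> Uz; rewrite ipC; have [exz Ez] := derivative_reprP (phi z) Cl.
  by rewrite -Ez//; apply: (eq_pd_seq _ oU) => // w Uw; exact: kE.
by rewrite -E//; apply: (eq_pd_seq _ oU).
Qed.

Lemma derivative_repr_closure (l : seq 'I_d) x : C l ->
  closure U x -> mixed_pd_limit l x ->
  exists v, forall f, pd_seq l (fun y => ip f (phi y)) y
    @[y --> within U (nbhs x)] --> ip f v.
Proof.
move=> Cl Ux [g Hg].
have PF : ProperFilter (within U (nbhs x)) by exact: within_nbhs_proper.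
have /cvg_ex[v vx] : cvg (derivative_repr l y @[y --> within U (nbhs x)]).
  apply: (gram_cvg ipE (g := g)) => e /Hg[r r0 Hr].
  exists [set y | U y /\ `|y - x| <= r].
    have : nbhs x [set y | `|y - x| <= r].
      have := @nbhsx_ballx _ _ x r r0; apply: filterS => y.
      by rewrite -ball_normE /= distrC => /ltW.
    by rewrite /within/=; apply: filterS => y.
  move=> i j [Ui xi] [Uj xj]; rewrite derivative_repr_gram//; exact: Hr.
exists v => f; apply: cvg_trans (cvg_ip ipE (f := f) vx).
apply: near_eq_cvg; apply: filterS (@withinT _ _ U _) => y Uy.
by rewrite (derivative_reprP f Cl).2.
Qed.

End ReproducingDerivatives.

(** * Multi-indices, and derivatives of functions on [X] *)

Lemma flatten_nseq_behead (I : eqType) (e : seq I) (r : I -> nat) i l :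
  uniq e -> flatten [seq nseq (r j) j | j <- e] = i :: l ->
  exists2 r' : I -> nat, (forall j, (r' j <= r j)%N) &
    l = flatten [seq nseq (r' j) j | j <- e].
Proof.
elim: e l => //= a e IH l /andP[ae ue]; case ra : (r a) => [|n] /=.
  move=> /(IH _ ue)[r' r'r ->]; exists r' => //.
  by have := r'r a; rewrite ra leqn0 => /eqP ->.
move=> [_ <-]; exists (fun j => if j == a then n else r j) => [j|].
  by case: eqP => // ->; rewrite ra.
(* By [uniq], [a] does not recur in [e], so lowering its multiplicity leaves the other blocks
   unchanged. *)
rewrite eqxx; congr (_ ++ flatten _); apply/eq_in_map => j je.
by case: eqP je ae => // -> ->.
Qed.

Lemma mseq_behead (d : nat) (r : mindex d) i l :
  mseq r = i :: l ->
  exists2 r' : mindex d, (morder r' <= morder r)%N & l = mseq r'.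
Proof.
move=> /(flatten_nseq_behead (enum_uniq _))[r' r'r ->].
exists (finfun r'); first by apply: leq_sum => j _; rewrite ffunE.
by congr flatten; apply: eq_map => j; rewrite ffunE.
Qed.

Lemma mseq_order0 (d : nat) (r : mindex d) : morder r = 0%N -> mseq r = [::].
Proof.
move=> /eqP; rewrite sum_nat_eq0 => /forallP r0.
by rewrite /mseq; elim: (enum _) => //= i e ->; rewrite (eqP (r0 i)).
Qed.

(** Interior derivatives, the value in order 0 and the limit along the interior all depend on [f]
    over [X] alone. *)
Lemma eq_pdX (R : realType) (d : nat) (X : set 'rV[R]_d) (r : mindex d)
    (f g : 'rV[R]_d -> R) x :
  X x -> (forall y, X y -> f y = g y) -> pdX X r f x = pdX X r g x.
Proof.
move=> Xx fg; rewrite /pdX.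
have fgU y : X° y -> pd r f y = pd r g y.
  by apply: eq_pd_seq; [exact: open_interior|move=> z /interior_subset/fg].
case: asboolP => [/fgU//|_] /=.
case: eqP => [/mseq_order0 r0|_]; first by rewrite /pd r0; exact: fg.
congr (lim _); apply/seteqP; split; apply: near_eq_cvg;
  apply: filterS (@withinT _ _ X° _) => y /fgU //.
Qed.

Lemma eq_O1_app (R : realType) (d s : nat) (X : set 'rV[R]_d) (D : O1 R d s)
    (f g : 'rV[R]_d -> R) x :
  X x -> (forall y, X y -> f y = g y) -> O1_app X D f x = O1_app X D g x.
Proof. by move=> Xx fg; apply: eq_bigr => t _; rewrite (eq_pdX _ Xx fg). Qed.

(** * Representers of differential operators in the RKHS *)

Section KernelDerivatives.
Variables (R : realType) (d Q s : nat) (X : set 'rV[R]_d).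
Variables (K : 'rV[R]_d -> 'rV[R]_d -> 'M[R]_Q) (F : vvRKHS X K).
Hypothesis hX : X `<=` closure X°.
Hypothesis hKs : Css s X K.
Hypothesis hK : forall x x', X x -> X x' -> K x x' = (K x' x)^T.

Local Notation ip := (rk_ip F).
Local Notation ipE := (@rk_normE _ _ _ _ _ F).

(** Picks the elements [K(., x) e_q] simultaneously, so that they form a map of [x] to which
    difference quotients apply; outside [X] the value is a dummy 0. *)
Lemma rk_reproducing_choice :
  exists phi : 'rV[R]_d -> 'I_Q -> F, forall x q, X x ->
    (forall x' i, X x' -> rk_ev (phi x q) x' i 0 = K x' x i q) /\
    (forall f, ip f (phi x q) = rk_ev f x q 0).
Proof.
have H (p : 'rV[R]_d * 'I_Q) : exists k : F, X p.1 ->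
    (forall x' i, X x' -> rk_ev k x' i 0 = K x' p.1 i p.2) /\
    (forall f, ip f k = rk_ev f p.1 p.2 0).
  have [Xx|nXx] := pselect (X p.1); last by exists 0.
  have [k kE kR] := @rk_reproducing _ _ _ _ _ F p.1 (delta_mx p.2 0) Xx.
  exists k => _; split=> [x' i Xx'|f].
    by rewrite kE// -colE mxE.
  rewrite kR /dotv (bigD1 p.2)//= mxE !eqxx mulr1 big1 ?addr0// => j jp.
  by rewrite mxE (negPf jp) mulr0.
have [phi Hphi] := choice H.
by exists (fun x q => phi (x, q)) => x q; exact: Hphi (x, q).
Qed.

Lemma Css_mixed_pd_limit (r : mindex d) q x0 : (morder r <= s)%N -> X x0 ->
  mixed_pd_limit X° (fun x y => K x y q q) (mseq r) x0.
Proof.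
move=> rs Xx0; have [_ /(_ r rs)[_ _ [G cG GE]]] := hKs q q.
move/subspace_continuousP: cG => cG.
have /cvgrPdist_le cG0 := cG (x0, x0) (conj Xx0 Xx0).
exists (G (x0, x0)) => e /cG0 [[A B] /= [Ax0 Bx0] AB].
(* The radius is halved below because balls are open while [mixed_pd_limit] uses non-strict
   bounds. *)
have /nbhs_ballP[r' /= r'0 Hr'] : nbhs x0 (A `&` B) by exact: filterI.
have r2 : 0 < r' / 2 by rewrite divr_gt0.
exists (r' / 2) => // x y Ux Uy xx0 yx0.
have inAB z : `|z - x0| <= r' / 2 -> (A `&` B) z.
  move=> zx0; apply: Hr'; rewrite -ball_normE /= distrC (le_lt_trans zx0)//.
  by rewrite ltr_pdivrMr// ltr_pMr// ltr1n.
rewrite /mixed_pd -[pd_seq _ _ x]GE// distrC.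
apply: (AB (x, y)) => /=.
  by split=> /=; [case: (inAB x xx0)|case: (inAB y yx0)].
by split; exact: interior_subset.
Qed.

(** Only the diagonal entry [K_qq] matters: it is the Gram kernel of the elements [K(., x) e_q]. The
    proof follows the three cases of [pdX]. *)
Lemma pdX_repr (r : mindex d) q x : (morder r <= s)%N -> X x ->
  exists v : F, forall f, ip f v = pdX X r (fun y => rk_ev f y q 0) x.
Proof.
move=> rs Xx; have [phi Hphi] := rk_reproducing_choice.
pose phiq y := phi y q.
have phiE f y : X y -> rk_ev f y q 0 = ip f (phiq y).
  by move=> /(Hphi _ q)[_ ->].
have kE y z : X° y -> X° z -> ip (phiq y) (phiq z) = K y z q q.
  move=> /interior_subset Xy /interior_subset Xz.
  rewrite -phiE//; have [-> //] := Hphi y q Xy.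
  by rewrite hK// mxE.
pose C l := exists2 r : mindex d, (morder r <= s)%N & l = mseq r.
have Cb i l : C (i :: l) -> C l.
  move=> [r' r's /esym/mseq_behead[r'' r''r' ->]]; exists r'' => //.
  exact: leq_trans r''r' r's.
have Cex l : C l -> mixed_pd_exists X° (fun x y => K x y q q) l.
  by move=> [r' /(hKs q q).2[? ? _] ->].
have Cl l y : C l -> X y -> mixed_pd_limit X° (fun x y => K x y q q) l y.
  by move=> [r' r's ->]; exact: Css_mixed_pd_limit.
have ClU l y : C l -> X° y -> mixed_pd_limit X° (fun x y => K x y q q) l y.
  by move=> Cl' /interior_subset; exact: Cl.
have Cr : C (mseq r) by exists r.
have oX := @open_interior _ X.
have pdE f y : X° y -> pd r (fun y => rk_ev f y q 0) y =
    pd_seq (mseq r) (fun y => ip f (phiq y)) y.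
  by apply: (eq_pd_seq _ oX) => z /interior_subset/phiE.
rewrite /pdX; case: asboolP => [Ux|_] /=.
  exists (derivative_repr phiq (mseq r) x) => f; rewrite pdE//.
  by rewrite (derivative_reprP ipE oX kE Cb Cex ClU f Cr).2.
case: eqP => [/mseq_order0 r0|_].
  by exists (phiq x) => f; rewrite /pd r0 /= phiE.
have [v Hv] := derivative_repr_closure ipE oX kE Cb Cex ClU Cr
  (hX Xx) (Cl _ _ Cr Xx).
exists v => f; apply/esym.
have PF : ProperFilter (within X° (nbhs x)) by apply: within_nbhs_proper; exact: hX.
apply: cvg_lim => //; apply: cvg_trans (Hv f); apply: near_eq_cvg.
by apply: filterS (@withinT _ _ X° _) => y Uy; rewrite pdE.
Qed.

Lemma O1_repr (D : O1 R d s) q x : X x ->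
  exists v : F, forall f, ip f v = O1_app X D (fun y => rk_ev f y q 0) x.
Proof.
move=> Xx; case: D => t /=; rewrite /O1_app /=; elim: t => [_|[c r] t IH /=].
  by exists 0 => f; rewrite big_nil linear0r.
move=> /andP[rs /IH[v Hv]]; have [w Hw] := pdX_repr q rs Xx.
by exists (c *: w + v) => f; rewrite big_cons ipDr ipZr Hv Hw.
Qed.

(** Evaluating [v] is pairing it with a kernel element. By symmetry of the pairing the operator then
    acts on that element, and kernel symmetry moves the action to the second argument of [K]. *)
Lemma O1_repr_ev (D : O1 R d s) q x (v : F) : X x ->
  (forall f, ip f v = O1_app X D (fun y => rk_ev f y q 0) x) ->
  forall x' i, X x' -> rk_ev v x' i 0 = O1_app X D (fun y => K x' y i q) x.
Proof.
move=> Xx Hv x' i Xx'; have [phi Hphi] := rk_reproducing_choice.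
have [evphi ipphi] := Hphi x' i Xx'.
rewrite -ipphi ipC Hv; apply: eq_O1_app => // y Xy.
by rewrite evphi// hK// mxE.
Qed.

Lemma rk_ev_sum (I : Type) (e : seq I) (c : I -> R) (v : I -> F) x : X x ->
  rk_ev (\sum_(i <- e) c i *: v i) x = \sum_(i <- e) c i *: rk_ev (v i) x.
Proof.
move=> Xx; elim: e => [|i e IH].
  (* Linearity with [a = -1] and both elements 0 shows that 0 evaluates to 0. *)
  rewrite !big_nil; have := @rk_ev_linear _ _ _ _ _ F (-1) 0 0 x Xx.
  by rewrite !scaleN1r oppr0 addr0 => ->; rewrite addNr.
by rewrite !big_cons rk_ev_linear// IH.
Qed.

(** The last clause asks of [w] only that it represent [Dt] at [x'], so representers obtained
    separately can be paired. *)
Definition OQ_representer (D : OQ R d Q s) x (v : F) : Prop :=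
  [/\ forall f, ip f v = OQ_app X D (rk_ev f) x,
      forall x', X x' -> rk_ev v x' = DK X K D x' x &
      forall (Dt : OQ R d Q s) x' w, X x' ->
        (forall f, ip f w = OQ_app X Dt (rk_ev f) x') ->
        ip v w = DtDK X K Dt D x' x].

Lemma OQ_repr (D : OQ R d Q s) x : X x -> exists v : F, OQ_representer D x v.
Proof.
move=> Xx; have [v Hv] := choice (fun q => O1_repr (OQ_comp D q) q Xx).
exists (\sum_(q < Q) OQ_coef D q *: v q); split=> [f|x' Xx'|Dt x' w Xx' Hw].
- by rewrite ip_sumr; apply: eq_bigr => q _; rewrite ipZr Hv.
- rewrite rk_ev_sum//; apply: eq_bigr => q _; congr (_ *: _).
  by apply/matrixP => i j; rewrite (ord1 j) (O1_repr_ev Xx (Hv q))// -colE !mxE.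
- rewrite ip_suml; apply: eq_bigr => q _; rewrite ipZl Hw mulr_sumr.
  apply: eq_bigr => q' _; rewrite mulrCA mulrA; congr (_ * _).
  by apply: eq_O1_app => // y' Xy'; rewrite (O1_repr_ev Xx (Hv q)).
Qed.

End KernelDerivatives.

(** * The RKHS norm of a function and the expansion of the square *)

Lemma rk_normE_ev (R : realType) (d Q : nat) (X : set 'rV[R]_d)
    (K : 'rV[R]_d -> 'rV[R]_d -> 'M[R]_Q) (F : vvRKHS X K)
    (g : 'rV[R]_d -> 'cV[R]_Q) (h : F) :
  (forall x, X x -> rk_ev h x = g x) -> rk_norm F g = (`|h|)%:E.
Proof.
move=> hg; rewrite /rk_norm -[RHS]ereal_inf1; congr ereal_inf.
apply/seteqP; split => [_ [h' /= h'g <-]|_ ->] /=; last by exists h.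
(* Injectivity of [rk_ev] makes the set of norms a singleton. *)
by congr (`| _ |)%:E; apply: rk_ev_inj => x Xx; rewrite h'g// hg.
Qed.

Lemma frobenius_tensor_act (R : realType) (P : nat) (T : tensor4 R P)
    (u : 'cV[R]_P) :
  frobenius (tensv u) (tensor_act T (tensv u)) =
  \sum_i \sum_j (u i 0 * u j 0) * \sum_n \sum_m (u n 0 * u m 0) * T i j n m.
Proof.
apply: eq_bigr => i _; apply: eq_bigr => j _; rewrite !mxE; congr (_ * _).
by apply: eq_bigr => n _; apply: eq_bigr => m _; rewrite mxE.
Qed.

Lemma ip_sum2 (R : realType) (V : normedModType R) (ip : {dot V for idfun})
    (P : nat) (c : 'I_P -> 'I_P -> R) (a b : 'I_P -> 'I_P -> V) :
  ip (\sum_i \sum_j c i j *: a i j) (\sum_i \sum_j c i j *: b i j) =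
  \sum_i \sum_j c i j * \sum_n \sum_m c n m * ip (a i j) (b n m).
Proof.
rewrite ip_suml; apply: eq_bigr => i _; rewrite ip_suml; apply: eq_bigr => j _.
rewrite ipZl ip_sumr; congr (_ * _); apply: eq_bigr => n _.
by rewrite ip_sumr; apply: eq_bigr => m _; rewrite ipZr.
Qed.

Theorem lemma4 (R : realType) (d Q s P : nat) (X : set 'rV[R]_d)
    (N : 'rV[R]_d -> R) (K : 'rV[R]_d -> 'rV[R]_d -> 'M[R]_Q)
    (F : vvRKHS X K) (D : 'I_P -> 'I_P -> OQ R d Q s)
    (hX : X `<=` closure X°)
    (hN : is_norm N)
    (hKs : Css s X K)
    (hK : is_kernel X K)
    (hP : (1 <= P)%N)
    (hD : forall (f : F) (x : 'rV[R]_d), X x ->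
      let A : 'M[R]_P := \matrix_(p1 < P, p2 < P) OQ_app X (D p1 p2) (rk_ev f) x in
      A^T = A)
    (xm : 'rV[R]_d) (hxm : X xm) (deltam : R) (hdelta : 0 < deltam) :
  eta_mP N F D xm deltam = eta X N K D xm deltam.
Proof.
(* The suprema range over the same pairs, so equality term by term suffices. *)
suff H x (u : 'cV[R]_P) : X x -> rk_norm F (fun x' =>
      \sum_(p1 < P) \sum_(p2 < P) (u p1 0 * u p2 0) *:
        (DK X K (D p1 p2) x' xm - DK X K (D p1 p2) x' x)) =
    (Num.sqrt `| frobenius (tensv u)
      (tensor_act (fun i j n m =>
         Ktensor X K D xm xm i j n m + Ktensor X K D x x i j n m
         - 2 * Ktensor X K D xm x i j n m) (tensv u)) |)%:E.
  rewrite /eta_mP /eta; congr ereal_sup; apply/seteqP.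
  by split=> _ [x [Xx xd] [u Su <-]]; exists x => //; exists u => //; rewrite H.
move=> Xx.
have representers y (Xy : X y) :=
  choice (fun p : 'I_P * 'I_P => OQ_repr F hX hKs hK.1 (D p.1 p.2) Xy).
have [[vm Hm] [vx Hx]] := (representers _ hxm, representers _ Xx).
pose S (v : 'I_P * 'I_P -> F) : F :=
  \sum_i \sum_j (u i 0 * u j 0) *: v (i, j).
have -> : frobenius (tensv u) (tensor_act (fun i j n m =>
      Ktensor X K D xm xm i j n m + Ktensor X K D x x i j n m
      - 2 * Ktensor X K D xm x i j n m) (tensv u)) = `|S vm - S vx| ^+ 2.
  (* The cross term is flipped because in [Ktensor X K D xm x i j n m] the operator [D i j] acts at
     [x] and [D n m] at [xm], so [vx] belongs in the first slot. *)
  rewrite (norm_ipB (@rk_normE _ _ _ _ _ F)) (ipC _ (S vm) (S vx)).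
  rewrite !ip_sum2 frobenius_tensor_act mulr_sumr -big_split -sumrB.
  apply: eq_bigr => i _; rewrite mulr_sumr -big_split -sumrB.
  apply: eq_bigr => j _ /=; rewrite mulrCA -mulrDr -mulrBr; congr (_ * _).
  rewrite mulr_sumr -big_split -sumrB; apply: eq_bigr => n _.
  rewrite mulr_sumr -big_split -sumrB; apply: eq_bigr => m _ /=.
  have [_ _ Hmij] := Hm (i, j); have [_ _ Hxij] := Hx (i, j).
  have [Hmnm _ _] := Hm (n, m); have [Hxnm _ _] := Hx (n, m).
  rewrite mulrCA -mulrDr -mulrBr; congr (_ * (_ + _ - _ * _)); apply/esym.
  - exact: Hmij.
  - exact: Hxij.
  - exact: Hxij.
rewrite normrX normr_id sqrtr_sqr normr_id.
apply: rk_normE_ev => x' Xx'.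
have -> : S vm - S vx = \sum_i \sum_j (u i 0 * u j 0) *: (vm (i, j) - vx (i, j)).
  rewrite /S -sumrB; apply: eq_bigr => i _; rewrite -sumrB.
  by apply: eq_bigr => j _; rewrite scalerBr.
rewrite !pair_big rk_ev_sum//; apply: eq_bigr => -[i j] _ /=; congr (_ *: _).
have [_ <- // _] := Hm (i, j); have [_ <- // _] := Hx (i, j).
by rewrite addrC -scaleN1r rk_ev_linear// scaleN1r addrC.
Qed.
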